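(* For any $\Phi=\{\phi_1,\dots,\phi_n\}\subset L^2(X,\rho)$, $f\in L^2(X,\rho)$ and $c\in\mathbb C^n$, one has $$\|\mathrm{fl}(\mathcal T)c-\mathrm{fl}(f)\|_{L^2_\rho}\ \le\ \|\mathcal Tc-f\|_{L^2_\rho}+u\left(\sqrt n\,\|\mathcal T\|_{2,L^2_\rho}\|c\|_2+\|f\|_{L^2_\rho}\right).$$
   Context: $X\subseteq\mathbb R^d$ is measurable, $\rho$ is a non-atomic probability measure on $X$, and $\|\cdot\|_{L^2_\rho}$ is the norm of the complex space $L^2(X,\rho)$. The synthesis operator of $\Phi$ is $\mathcal T:\mathbb C^n\to L^2(X,\rho)$, $\mathcal Tc=\sum_{i=1}^n c_i\phi_i$, and $\|\mathcal T\|_{2,L^2_\rho}=\sup_{c\ne0}\|\mathcal Tc\|_{L^2_\rho}/\|c\|_2$. No linear independence of $\Phi$ is assumed. $\mathrm{fl}:\mathbb C\to\mathbb C$ is a (measurable) rounding map with unit roundoff $u>0$: for every $y\in\mathbb C$ there is $\delta\in\mathbb C$ with $|\delta|\le u$ and $\mathrm{fl}(y)=y(1+\delta)$. For $v\in L^2(X,\rho)$, $\mathrm{fl}(v)=\mathrm{fl}\circ v\in L^2(X,\rho)$. The numerical synthesis operator is $\mathrm{fl}(\mathcal T)c=\sum_{i=1}^n c_i\,\mathrm{fl}(\phi_i)$. *)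

(* Defs.v *)
From HB Require Import structures.
From mathcomp Require Import all_boot all_order all_algebra.
From mathcomp Require Import all_classical all_reals all_analysis.
From mathcomp Require Import complex.

Set Implicit Arguments.
Unset Strict Implicit.
Unset Printing Implicit Defensive.

Import Order.TTheory GRing.Theory Num.Theory.
Import numFieldNormedType.Exports.
Import ComplexField.Normc.

Local Open Scope classical_set_scope.
Local Open Scope ring_scope.
Local Open Scope complex_scope.

(* R^d with its Borel sigma-algebra. *)
Definition Rd (R : realType) (d : nat) := g_sigma_algebraType (@open 'rV[R]_d).

(* A measurableType must be pointed, so the type of points of X can only be
   made measurable for nonempty X; a set carrying a probability measure is
   nonempty. *)
Definition pointed_set (T : Type) (X : set T) (X0 : X !=set0) : Type :=
  set_type X.

Section pointed_set.
Variables (T : choiceType) (X : set T) (X0 : X !=set0).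

HB.instance Definition _ := Choice.copy (pointed_set X0) (set_type X).
HB.instance Definition _ := isPointed.Build (pointed_set X0)
  (SigSub (mem_set (projT2 (cid X0)))).

End pointed_set.

(* The set X as a measurable space, with the trace of the Borel sigma-algebra
   of R^d, i.e. the sets X `&` B with B Borel. *)
Definition dom (R : realType) (d : nat) (X : set (Rd R d)) (X0 : X !=set0) :=
  g_sigma_algebra_preimageType (fun x : pointed_set X0 => val x : Rd R d).

HB.instance Definition _ (R : realType) := isPointed.Build R[i] 0.

(* The complex numbers with the sigma-algebra of R * R, through
   z |-> (Re z, Im z). *)
Definition Cborel (R : realType) :=
  g_sigma_algebra_preimageType (fun z : R[i] => (complex.Re z, complex.Im z)).

Definition cmeasurable (R : realType) (d : measure_display)
    (T : measurableType d) (f : T -> R[i]) :=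
  measurable_fun [set: T] (f : T -> Cborel R).

Definition nonatomic (R : realType) (d : measure_display)
    (T : measurableType d) (mu : {measure set T -> \bar R}) :=
  forall A : set T, measurable A -> (0 < mu A)%E ->
    exists B : set T, [/\ measurable B, B `<=` A & (0 < mu B < mu A)%E].

Section L2.
Variables (R : realType) (d : measure_display) (T : measurableType d).
Variable mu : {measure set T -> \bar R}.

(* Extended-real valued, +oo when |f|^2 is not integrable. *)
Definition L2norm (f : T -> R[i]) : \bar R :=
  ('N[mu]_2%:E[EFin \o (@normc R \o f)])%E.

Definition L2 : set (T -> R[i]) :=
  [set f | cmeasurable f /\ (L2norm f < +oo)%E].

Definition norm2 (n : nat) (c : 'cV[R[i]]_n) : R :=
  Num.sqrt (\sum_(i < n) normc (c i 0) ^+ 2).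

(* For n = 0 the supremum is that of the empty set, -oo; the factor sqrt n = 0
   then makes the product 0. *)
Definition opnorm (n : nat) (S : 'cV[R[i]]_n -> T -> R[i]) : \bar R :=
  ereal_sup [set (L2norm (S c) * ((norm2 c)^-1)%:E)%E | c in [set c | c != 0]].

End L2.

Definition synthesis (R : realType) (T : Type) (n : nat)
    (phi : 'I_n -> T -> R[i]) (c : 'cV[R[i]]_n) : T -> R[i] :=
  fun x => \sum_(i < n) c i 0 * phi i x.

Definition fl_synthesis (R : realType) (T : Type) (fl : R[i] -> R[i]) (n : nat)
    (phi : 'I_n -> T -> R[i]) (c : 'cV[R[i]]_n) : T -> R[i] :=
  fun x => \sum_(i < n) c i 0 * fl (phi i x).

Definition is_rounding (R : realType) (u : R) (fl : R[i] -> R[i]) :=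
  @cmeasurable R _ (Cborel R) fl /\
  forall y : R[i], exists delta : R[i],
    normc delta <= u /\ fl y = y * (1 + delta).

(* Main.v *)
Require Import Defs.
From HB Require Import structures.
From mathcomp Require Import all_boot all_order all_algebra.
From mathcomp Require Import all_classical all_reals all_analysis.
From mathcomp Require Import complex.
From mathcomp Require Import measurable_realfun ring lra.

Set Implicit Arguments.
Unset Strict Implicit.
Unset Printing Implicit Defensive.

Import Order.TTheory GRing.Theory Num.Theory.
Import numFieldNormedType.Exports.

Local Open Scope classical_set_scope.
Local Open Scope ring_scope.

(** The difference to be bounded splits as
      fl(T)c - fl(f) = (Tc - f) + (fl(T)c - Tc) - (fl(f) - f),
    so Minkowski's inequality leaves two rounding errors to estimate.

    A rounding map satisfies |fl(y) - y| <= u |y| at every y, hence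
    ||fl(v) - v|| <= u ||v|| for every measurable v ([L2norm_rounding_error]);
    taking v = f gives the term u ||f||.

    The error fl(T)c - Tc is itself a synthesis: that of the family of errors
    fl(phi_i) - phi_i, with the same coefficients. The triangle inequality
    bounds its norm by u times the sum of the |c_i| ||phi_i||. Each phi_i is
    the image of a unit vector, so ||phi_i|| <= ||T|| ([L2norm_le_opnorm]),
    and Cauchy-Schwarz turns the remaining l^1 norm of c into
    sqrt(n) ||c||_2 ([norm1_le_norm2]).

    The norms are extended real numbers. Multiplying an inequality by the
    operator norm requires it to be nonnegative, which holds as soon as n > 0;
    for n = 0 both sides of the bound on fl(T)c - Tc vanish. *)

(** * Measurable complex-valued functions *)

(** This reduces measurability of complex functions to the theory of measurable
    real functions. *)
Lemma cmeasurableP (R : realType) (d : measure_display) (T : measurableType d)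
    (f : T -> R[i]) :
  cmeasurable f <->
  measurable_fun [set: T] (fun x => complex.Re (f x)) /\
  measurable_fun [set: T] (fun x => complex.Im (f x)).
Proof.
pose ReIm (z : R[i]) := (complex.Re z, complex.Im z).
split=> [mf|[mRe mIm]].
  have mReIm : measurable_fun [set: T] (ReIm \o f).
    move=> _ B mB; rewrite setTI comp_preimage -[X in measurable X]setTI.
    by apply: mf => //; exists B => //; rewrite setTI.
  by have [] := (measurable_fun_pairP _).1 mReIm.
move=> _ _ [B mB <-]; rewrite setTI.
suff mReIm : measurable_fun [set: T] (ReIm \o f).
  by have := mReIm measurableT _ mB; rewrite comp_preimage.
by apply/measurable_fun_pairP; split.
Qed.

Section cmeasurable_operations.
Context (R : realType) (d : measure_display) (T : measurableType d).
Implicit Types (f g : T -> R[i]) (z : R[i]).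

Lemma cmeasurableD f g : cmeasurable f -> cmeasurable g ->
  cmeasurable (fun x => f x + g x).
Proof.
move=> /cmeasurableP[mRf mIf] /cmeasurableP[mRg mIg]; apply/cmeasurableP; split.
  by under eq_fun do rewrite raddfD/=; exact: measurable_funD.
by under eq_fun do rewrite raddfD/=; exact: measurable_funD.
Qed.

Lemma cmeasurableZ z f : cmeasurable f -> cmeasurable (fun x => z * f x).
Proof.
case: z => a b /cmeasurableP[mRf mIf]; apply/cmeasurableP; split.
  rewrite (_ : (fun x => _) =
    fun x => a * complex.Re (f x) - b * complex.Im (f x)); last first.
    by apply/funext => x; case: (f x).
  by apply: measurable_funB; apply: measurable_funM.
rewrite (_ : (fun x => _) =
  fun x => a * complex.Im (f x) + b * complex.Re (f x)); last first.
  by apply/funext => x; case: (f x).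
by apply: measurable_funD; apply: measurable_funM.
Qed.

Lemma cmeasurableN f : cmeasurable f -> cmeasurable (fun x => - f x).
Proof.
by move=> mf; under eq_fun do rewrite -mulN1r; exact: cmeasurableZ.
Qed.

Lemma cmeasurableB f g : cmeasurable f -> cmeasurable g ->
  cmeasurable (fun x => f x - g x).
Proof. by move=> mf mg; apply: cmeasurableD => //; exact: cmeasurableN. Qed.

Lemma cmeasurable_sum (I : Type) (s : seq I) (h : I -> T -> R[i]) :
  (forall i, cmeasurable (h i)) -> cmeasurable (fun x => \sum_(i <- s) h i x).
Proof.
move=> mh; elim: s => [|i s IHs].
  under eq_fun do rewrite big_nil.
  by apply/cmeasurableP; split; exact: measurable_cst.
by under eq_fun do rewrite big_cons; exact: cmeasurableD.
Qed.

Lemma measurable_normc f : cmeasurable f ->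
  measurable_fun [set: T] (@ComplexField.Normc.normc R \o f).
Proof.
move=> /cmeasurableP[mRf mIf].
have -> : @ComplexField.Normc.normc R \o f =
    fun x => (complex.Re (f x) ^+ 2 + complex.Im (f x) ^+ 2) `^ 2^-1.
  apply/funext => x /=; case: (f x) => a b /=.
  by rewrite powR12_sqrt// addr_ge0// sqr_ge0.
apply: (measurableT_comp (measurable_powR _)).
by apply: measurable_funD; apply: measurable_funX.
Qed.

End cmeasurable_operations.

(** * The L2 norm of complex-valued functions *)

Lemma normc_ge0 (R : realType) (z : R[i]) :
  0 <= ComplexField.Normc.normc z.
Proof. by case: z => a b /=; exact: sqrtr_ge0. Qed.

Lemma normc_real (R : realType) (r : R) :
  ComplexField.Normc.normc r%:C%C = `|r|.
Proof. by rewrite /= expr0n/= addr0 sqrtr_sqr. Qed.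

Section L2norm_theory.
Context (R : realType) (d : measure_display) (T : measurableType d).
Variable mu : {measure set T -> \bar R}.
Implicit Types (f g : T -> R[i]) (z : R[i]).
Local Notation normc := (@ComplexField.Normc.normc R).

Lemma L2norm_ge0 f : (0 <= L2norm mu f)%E.
Proof. exact: Lnorm_ge0. Qed.

Lemma L2normE f :
  L2norm mu f = ((\int[mu]_x ((normc (f x)) ^+ 2)%:E) `^ 2^-1)%E.
Proof.
rewrite /L2norm unlock; congr (_ `^ _)%E; apply: eq_integral => x _ /=.
by rewrite ger0_norm ?normc_ge0// powR_mulrn ?normc_ge0.
Qed.

Let measurable_sqr_normc f : cmeasurable f ->
  measurable_fun [set: T] (fun x => ((normc (f x)) ^+ 2)%:E).
Proof.
move=> mf; apply/measurable_EFinP.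
exact: (measurable_funX 2 (measurable_normc mf)).
Qed.

Let integral_sqr_normc_ge0 f : (0 <= \int[mu]_x ((normc (f x)) ^+ 2)%:E)%E.
Proof. by apply: integral_ge0 => x _; rewrite lee_fin sqr_ge0. Qed.

Lemma le_L2norm f g : cmeasurable f -> cmeasurable g ->
  (forall x, normc (f x) <= normc (g x)) -> (L2norm mu f <= L2norm mu g)%E.
Proof.
move=> mf mg fg; rewrite !L2normE.
apply: gt0_ler_poweR; rewrite ?in_itv/= ?leey ?andbT ?integral_sqr_normc_ge0//.
apply: ge0_le_integral => //; try exact: measurable_sqr_normc.
- by move=> x _; rewrite lee_fin sqr_ge0.
- by move=> x _; rewrite lee_fin lerXn2r// nnegrE normc_ge0.
Qed.

Lemma L2normZ z f : cmeasurable f ->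
  L2norm mu (fun x => z * f x) = ((normc z)%:E * L2norm mu f)%E.
Proof.
move=> mf; rewrite !L2normE.
under eq_integral do
  rewrite ComplexField.Normc.normcM exprMn EFinM.
rewrite ge0_integralZl_EFin ?sqr_ge0//.
- rewrite poweRM ?lee_fin ?sqr_ge0//.
  by rewrite poweR_EFin powR12_sqrt ?sqr_ge0// sqrtr_sqr ger0_norm ?normc_ge0.
- by move=> x _; rewrite lee_fin sqr_ge0.
- exact: measurable_sqr_normc.
Qed.

Lemma L2normN f : L2norm mu (fun x => - f x) = L2norm mu f.
Proof. by rewrite /L2norm; apply: eq_Lnorm => x /=; rewrite normcN. Qed.

(** The inequality follows from the real Minkowski inequality applied to the
    moduli |f| and |g|, since |f + g| <= |f| + |g| pointwise. *)
Lemma ler_L2normD f g : cmeasurable f -> cmeasurable g ->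
  (L2norm mu (fun x => (f x + g x)%R) <= L2norm mu f + L2norm mu g)%E.
Proof.
move=> mf mg; have mnf := measurable_normc mf; have mng := measurable_normc mg.
apply: (le_trans _ (minkowski_EFin mu mnf mng _)); last by rewrite ler1n.
(* |f| + |g| is seen as a complex function so that monotonicity of the L2 norm
   applies to it. *)
pose s x : R[i] := (normc (f x) + normc (g x))%:C%C.
have ns x : normc (s x) = normc (f x) + normc (g x).
  by rewrite normc_real ger0_norm// addr_ge0 ?normc_ge0.
have -> : 'N[mu]_2%:E[EFin \o ((normc \o f) \+ (normc \o g))%R]%E = L2norm mu s.
  by apply: eq_Lnorm => x; exact: (congr1 EFin (esym (ns x))).
apply: le_L2norm.
- exact: cmeasurableD.
- apply/cmeasurableP; split; first exact: measurable_funD.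
  exact: measurable_cst.
- by move=> x; rewrite ns le_normcD.
Qed.

Lemma ler_L2normB f g : cmeasurable f -> cmeasurable g ->
  (L2norm mu (fun x => (f x - g x)%R) <= L2norm mu f + L2norm mu g)%E.
Proof.
by move=> mf mg; rewrite -(L2normN g) ler_L2normD//; exact: cmeasurableN.
Qed.

Lemma ler_L2norm_sum (I : Type) (s : seq I) (h : I -> T -> R[i]) :
  (forall i, cmeasurable (h i)) ->
  (L2norm mu (fun x => (\sum_(i <- s) h i x)%R)
   <= \sum_(i <- s) L2norm mu (h i))%E.
Proof.
move=> mh; elim: s => [|i s IHs].
  rewrite big_nil /L2norm.
  rewrite (@eq_Lnorm _ _ _ _ _ _ (cst 0%E)) ?Lnorm0// => x /=.
  by rewrite big_nil ComplexField.Normc.normc0.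
under [X in L2norm _ X]eq_fun do rewrite big_cons.
rewrite big_cons; apply: le_trans (leeD2l _ IHs).
by apply: ler_L2normD => //; exact: cmeasurable_sum.
Qed.

End L2norm_theory.

(** * Rounding errors *)

Section rounding.
Context (R : realType) (d : measure_display) (T : measurableType d).
Variable mu : {measure set T -> \bar R}.
Variables (u : R) (fl : R[i] -> R[i]).
Hypotheses (u0 : 0 <= u) (hfl : is_rounding u fl).
Local Notation normc := (@ComplexField.Normc.normc R).

Lemma cmeasurable_fl (v : T -> R[i]) : cmeasurable v ->
  cmeasurable (fun x => fl (v x)).
Proof. exact: (measurableT_comp hfl.1). Qed.

(** Pointwise, fl(v) - v = v delta with |delta| <= u. *)
Lemma L2norm_rounding_error (v : T -> R[i]) : cmeasurable v ->
  (L2norm mu (fun x => (fl (v x) - v x)%R) <= u%:E * L2norm mu v)%E.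
Proof.
move=> mv; have uE : u = normc u%:C%C by rewrite normc_real ger0_norm.
rewrite [X in X%:E]uE -L2normZ//; apply: le_L2norm.
- by apply: cmeasurableB => //; exact: cmeasurable_fl.
- exact: cmeasurableZ.
move=> x; have [delta [delta_le ->]] := hfl.2 (v x).
rewrite mulrDr mulr1 addrAC subrr add0r mulrC !ComplexField.Normc.normcM.
by rewrite ler_wpM2r ?normc_ge0// -uE.
Qed.

End rounding.

(** * The synthesis operator *)

(** The Cauchy-Schwarz inequality against the constant vector 1: the square of
    the sum expands into the a_i a_j, and a_i a_j <= (a_i ^ 2 + a_j ^ 2) / 2. *)
Lemma sqr_sum_le (R : realFieldType) (n : nat) (a : 'I_n -> R) :
  (\sum_i a i) ^+ 2 <= n%:R * \sum_i a i ^+ 2.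
Proof.
have -> : (\sum_i a i) ^+ 2 = \sum_i \sum_j a i * a j.
  by rewrite expr2 mulr_suml; apply: eq_bigr => i _; rewrite mulr_sumr.
have -> : n%:R * \sum_i a i ^+ 2 = \sum_i \sum_j (a i ^+ 2 + a j ^+ 2) / 2.
  under [RHS]eq_bigr do rewrite -mulr_suml big_split/= sumr_const card_ord.
  rewrite -mulr_suml big_split/= sumr_const card_ord sumrMnl -mulr2n.
  by rewrite -[_ *+ n *+ 2]mulr_natr mulfK ?pnatr_eq0// mulr_natl.
apply: ler_sum => i _; apply: ler_sum => j _.
by have := sqr_ge0 (a i - a j); rewrite sqrrB; lra.
Qed.

Lemma norm1_le_norm2 (R : realType) (n : nat) (c : 'cV[R[i]]_n) :
  \sum_i ComplexField.Normc.normc (c i 0) <= Num.sqrt n%:R * norm2 c.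
Proof.
rewrite /norm2 -sqrtrM ?ler0n// -[leLHS]ger0_norm -?sqrtr_sqr; last first.
  by apply: sumr_ge0 => i _; exact: normc_ge0.
by rewrite ler_wsqrtr// sqr_sum_le.
Qed.

Section synthesis_theory.
Context (R : realType) (d : measure_display) (T : measurableType d).
Variable mu : {measure set T -> \bar R}.
Variables (n : nat) (phi : 'I_n -> T -> R[i]).
Local Notation normc := (@ComplexField.Normc.normc R).

Lemma cmeasurable_synthesis (c : 'cV[R[i]]_n) :
  (forall i, cmeasurable (phi i)) -> cmeasurable (synthesis phi c).
Proof. by move=> mphi; apply: cmeasurable_sum => i; exact: cmeasurableZ. Qed.

Lemma ler_L2norm_synthesis (c : 'cV[R[i]]_n) :
  (forall i, cmeasurable (phi i)) ->
  (L2norm mu (synthesis phi c)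
   <= \sum_i (normc (c i 0))%:E * L2norm mu (phi i))%E.
Proof.
move=> mphi; under eq_bigr do rewrite -L2normZ//.
by apply: ler_L2norm_sum => i; exact: cmeasurableZ.
Qed.

(** phi_i is the image of the i-th unit vector. *)
Lemma L2norm_le_opnorm i : (L2norm mu (phi i) <= opnorm mu (synthesis phi))%E.
Proof.
pose e : 'cV[R[i]]_n := delta_mx i 0.
have eE j : e j 0 = (j == i)%:R by rewrite mxE eqxx andbT.
apply: ereal_sup_ubound; exists e => /=.
  by apply/eqP => /matrixP/(_ i 0)/eqP; rewrite eE eqxx mxE oner_eq0.
have -> : norm2 e = 1.
  rewrite /norm2 (bigD1 i)//= big1 ?addr0 => [|j /negPf ji].
    by rewrite eE eqxx ComplexField.Normc.normc1 expr1n sqrtr1.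
  by rewrite eE ji ComplexField.Normc.normc0 expr0n.
rewrite invr1 mule1; congr L2norm; apply/funext => x.
rewrite /synthesis (bigD1 i)//= big1 ?addr0 => [|j /negPf ji].
  by rewrite eE eqxx mul1r.
by rewrite eE ji mul0r.
Qed.

(** This bounds the sum of the norms |c_i| ||phi_i|| and not merely ||Tc||,
    because the terms c_i phi_i may cancel while their rounding errors add up:
    the errors are controlled only term by term. *)
Lemma ler_sum_coef_opnorm (c : 'cV[R[i]]_n) :
  (\sum_i (normc (c i 0))%:E * L2norm mu (phi i)
   <= (Num.sqrt n%:R)%:E * opnorm mu (synthesis phi) * (norm2 c)%:E)%E.
Proof.
(* For n = 0 the operator norm is -oo, the supremum of the empty set, and only
   the factor sqrt 0 makes the right-hand side 0. *)
have [n0|n0] := posnP n.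
  rewrite big1 => [|k _]; last by have := ltn_ord k; rewrite [X in (_ < X)%N]n0.
  by rewrite [X in X%:R]n0 sqrtr0 !mul0e.
have opnorm0 : (0 <= opnorm mu (synthesis phi))%E.
  exact: le_trans (L2norm_ge0 _ _) (L2norm_le_opnorm (Ordinal n0)).
apply: (@le_trans _ _
    (\sum_i (normc (c i 0))%:E * opnorm mu (synthesis phi))%E).
  apply: lee_sum => i _; rewrite lee_wpmul2l ?lee_fin ?normc_ge0//.
  exact: L2norm_le_opnorm.
rewrite -ge0_sume_distrl => [|i _]; last by rewrite lee_fin normc_ge0.
rewrite sumEFin muleAC -EFinM lee_wpmul2r// lee_fin.
exact: norm1_le_norm2.
Qed.

End synthesis_theory.

(** fl(T)c - Tc is the synthesis with coefficients c of the family
    fl(phi_i) - phi_i. *)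
Lemma L2norm_fl_synthesis_error (R : realType) (d : measure_display)
    (T : measurableType d) (mu : {measure set T -> \bar R})
    (u : R) (u0 : 0 <= u) (fl : R[i] -> R[i]) (hfl : is_rounding u fl)
    (n : nat) (phi : 'I_n -> T -> R[i])
    (mphi : forall i, cmeasurable (phi i)) (c : 'cV[R[i]]_n) :
  (L2norm mu (fun x => (fl_synthesis fl phi c x - synthesis phi c x)%R)
   <= u%:E * ((Num.sqrt n%:R)%:E * opnorm mu (synthesis phi)
                * (norm2 c)%:E))%E.
Proof.
pose err i x := fl (phi i x) - phi i x.
have merr i : cmeasurable (err i).
  by apply: cmeasurableB => //; exact: (cmeasurable_fl hfl).
have -> : (fun x => fl_synthesis fl phi c x - synthesis phi c x) =
    synthesis err c.
  apply/funext => x; rewrite /fl_synthesis /synthesis -sumrB.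
  by apply: eq_bigr => i _; rewrite mulrBr.
apply: le_trans (ler_L2norm_synthesis mu c merr) _.
apply: le_trans (lee_wpmul2l _ (ler_sum_coef_opnorm _ _ _)); last first.
  by rewrite lee_fin.
rewrite ge0_sume_distrr => [|i _]; last first.
  by rewrite mule_ge0 ?L2norm_ge0// lee_fin normc_ge0.
apply: lee_sum => i _; rewrite muleCA lee_wpmul2l ?lee_fin ?normc_ge0//.
exact: L2norm_rounding_error.
Qed.

(** * The rounded residual *)

Theorem proposition3 (R : realType) (d : nat)
  (X : set (Rd R d)) (mX : measurable X) (X0 : X !=set0)
  (rho : probability (dom X0) R) (rho_na : nonatomic rho)
  (u : R) (u0 : 0 < u) (fl : R[i] -> R[i]) (hfl : is_rounding u fl)
  (n : nat) (phi : 'I_n -> dom X0 -> R[i]) (hphi : forall i, L2 rho (phi i))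
  (f : dom X0 -> R[i]) (hf : L2 rho f) (c : 'cV[R[i]]_n) :
  (L2norm rho (fun x => (fl_synthesis fl phi c x - fl (f x))%R)
   <= L2norm rho (fun x => (synthesis phi c x - f x)%R)
      + u%:E * ((Num.sqrt n%:R)%:E * opnorm rho (synthesis phi)
                  * (norm2 c)%:E
                + L2norm rho f))%E.
Proof.
have u_ge0 := ltW u0.
have mphi i : cmeasurable (phi i) by have [] := hphi i.
have mf : cmeasurable f by have [] := hf.
have mTc := cmeasurable_synthesis c mphi.
have mflTc : cmeasurable (fl_synthesis fl phi c).
  by apply: (cmeasurable_synthesis c) => i; exact: (cmeasurable_fl hfl).
have mflf := cmeasurable_fl hfl mf.
have -> : (fun x => fl_synthesis fl phi c x - fl (f x)) =
    (fun x => (synthesis phi c x - f x) +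
      ((fl_synthesis fl phi c x - synthesis phi c x) - (fl (f x) - f x))).
  by apply/funext => x; ring.
have mres := cmeasurableB mTc mf.
have msyn := cmeasurableB mflTc mTc.
have mtgt := cmeasurableB mflf mf.
apply: le_trans (ler_L2normD _ mres (cmeasurableB msyn mtgt)) _.
rewrite leeD2l//.
apply: le_trans (ler_L2normB _ msyn mtgt) _.
rewrite ge0_muleDr ?L2norm_ge0//; last first.
  by apply: le_trans (ler_sum_coef_opnorm _ _ _); apply: sume_ge0 => i _;
    rewrite mule_ge0 ?L2norm_ge0// lee_fin normc_ge0.
apply: leeD; first exact: L2norm_fl_synthesis_error.
exact: L2norm_rounding_error.
Qed.
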